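(* Let $n$ be a positive integer such that $K_{n,n,n,n}$ and $K_{n,n}$ (the complete multipartite graphs with four, respectively two, parts of size $n$, of orders $4n$ and $2n$) are $n$-antipodal graphs. Then $K_{n,n}\boxtimes K_2$ and $K_{n,n,n,n}$ are not $\varepsilon$-cospectral, and they are $\varepsilon$-equienergetic, i.e. $E_{\varepsilon}(K_{n,n}\boxtimes K_2)=E_{\varepsilon}(K_{n,n,n,n})$.
   Context: All graphs are finite, undirected, without loops or multiple edges. For a connected graph $G$, $d_G(u,v)$ is the distance between vertices $u,v$, and the eccentricity of $u$ is $\varepsilon(u)=\max\{d_G(u,v): v\in V(G)\}$. The eccentricity matrix $\varepsilon(G)=(\epsilon_{uv})$ is the symmetric matrix indexed by $V(G)$ with $\epsilon_{uv}=d_G(u,v)$ if $d_G(u,v)=\min\{\varepsilon(u),\varepsilon(v)\}$ and $\epsilon_{uv}=0$ otherwise. The $\varepsilon$-spectrum of $G$ is the multiset of eigenvalues of $\varepsilon(G)$, and the $\varepsilon$-energy $E_{\varepsilon}(G)$ is the sum of the absolute values of these eigenvalues, counted with multiplicity. Two graphs are $\varepsilon$-cospectral if they have the same $\varepsilon$-spectrum, and $\varepsilon$-equienergetic if they have the same $\varepsilon$-energy. For a connected graph $G$ of diameter $d$ and a vertex $u$, let $G_d(u)$ be the set of vertices at distance $d$ from $u$. $G$ is antipodal if for every vertex $u$ the set $\{u\}\cup G_d(u)$ consists of vertices mutually at distance $d$; equivalently, the vertex set can be partitioned into classes (fibres) so that two distinct vertices are in the same class if and only if they are at distance $d$. If all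 the fibres have the same cardinality $a$, $G$ is called $a$-antipodal. The strong product $G\boxtimes H$ of $G=(V,E)$ and $H=(W,F)$ has vertex set $V\times W$; two distinct vertices $(v_1,w_1)$ and $(v_2,w_2)$ are adjacent if and only if ($v_1=v_2$ or $v_1v_2\in E$) and ($w_1=w_2$ or $w_1w_2\in F$). *)

(* Defs.v *)
From mathcomp Require Import all_boot all_order all_algebra all_field.

Set Implicit Arguments.
Unset Strict Implicit.
Unset Printing Implicit Defensive.

Import Order.TTheory GRing.Theory Num.Theory.
Local Open Scope ring_scope.

Record sgraph := SGraph {
  vertex :> finType;
  adj : rel vertex;
  adj_sym : symmetric adj;
  adj_irr : irreflexive adj
}.

Arguments adj {s} u v : rename.

Section Metric.
Variable G : sgraph.
Implicit Types u v : G.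

Definition connected : Prop := forall u v, connect adj u v.

Definition has_walk (k : nat) u v : bool :=
  [exists p : k.-tuple G, path adj u p && (last u p == v)].

(* A shortest walk has length < #|G|; the value is #|G| when v cannot be
   reached from u. *)
Definition dist u v : nat := find (fun k => has_walk k u v) (iota 0 #|G|).

Definition ecc u : nat := \max_(v : G) dist u v.

Definition diam : nat := \max_(u : G) ecc u.

Definition fibre u : {set G} := u |: [set v | dist u v == diam].

Definition antipodal : Prop :=
  connected /\
  forall u v w, v \in fibre u -> w \in fibre u -> v != w -> dist v w = diam.

Definition a_antipodal (a : nat) : Prop :=
  antipodal /\ forall u, #|fibre u| = a.

Definition ecc_entry u v : nat :=
  if dist u v == minn (ecc u) (ecc v) then dist u v else 0%N.

Definition ecc_matrix : 'M[algC]_#|G| :=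
  \matrix_(i, j) (ecc_entry (enum_val i) (enum_val j))%:R.

(* The roots of the characteristic polynomial, listed with multiplicity.
   They are real, as the matrix is real symmetric, so the norm of algC is the
   usual absolute value on them. *)
Definition ecc_spectrum : seq algC :=
  sval (closed_field_poly_normal (char_poly ecc_matrix)).

Definition ecc_energy : algC := \sum_(x <- ecc_spectrum) `|x|.

End Metric.

(* Equality of multisets. *)
Definition ecc_cospectral (G H : sgraph) : Prop :=
  perm_eq (ecc_spectrum G) (ecc_spectrum H).

Definition ecc_equienergetic (G H : sgraph) : Prop :=
  ecc_energy G = ecc_energy H.

Section StrongProduct.
Variables G H : sgraph.

Definition strong_adj : rel (G * H)%type := fun x y =>
  [&& x != y, (x.1 == y.1) || adj x.1 y.1 & (x.2 == y.2) || adj x.2 y.2].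

Lemma strong_adj_sym : symmetric strong_adj.
Proof.
move=> x y; rewrite /strong_adj (eq_sym x) (eq_sym x.1) (eq_sym x.2).
by rewrite (adj_sym x.1) (adj_sym x.2).
Qed.

Lemma strong_adj_irr : irreflexive strong_adj.
Proof. by move=> x; rewrite /strong_adj eqxx. Qed.

Definition strong_product : sgraph := SGraph strong_adj_sym strong_adj_irr.

End StrongProduct.

Section CompleteGraphs.
Variables k n : nat.

Definition complete_adj : rel 'I_k := fun i j => i != j.

Lemma complete_adj_sym : symmetric complete_adj.
Proof. by move=> i j; rewrite /complete_adj eq_sym. Qed.

Lemma complete_adj_irr : irreflexive complete_adj.
Proof. by move=> i; rewrite /complete_adj eqxx. Qed.

Definition complete_graph : sgraph := SGraph complete_adj_sym complete_adj_irr.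

(* (i, a) is the a-th vertex of the i-th of k parts, each of size n. *)
Definition multipartite_adj : rel ('I_k * 'I_n)%type := fun x y => x.1 != y.1.

Lemma multipartite_adj_sym : symmetric multipartite_adj.
Proof. by move=> x y; rewrite /multipartite_adj eq_sym. Qed.

Lemma multipartite_adj_irr : irreflexive multipartite_adj.
Proof. by move=> x; rewrite /multipartite_adj eqxx. Qed.

Definition complete_multipartite : sgraph :=
  SGraph multipartite_adj_sym multipartite_adj_irr.

End CompleteGraphs.

(* Main.v *)
(* Both graphs have diameter 2, and in both two vertices are at distance 2 iff
   they lie in the same part p but in different classes q, for a partition q
   refining p (for K_{n,n,n,n} the classes are singletons, for the strong
   product they are the pairs of twins). If classes have size c and parts have
   size m, then M = 2 (P - Q) with P, Q the 0-1 matrices of the two partitions,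
   where PP = mP, PQ = QP = cP and QQ = cQ. Hence the eigenvalues of M are among
   0, 2(m - c) and -2c, so |x| is a fixed quadratic polynomial in x on the
   spectrum, and the energy is determined by tr M and tr M^2. The values of
   tr M^2, the sum of squared eigenvalues, differ when n > 1; when n = 1 the
   graph K_{1,1} = K_2 is not 1-antipodal. *)
Require Import Defs.
From mathcomp Require Import all_boot all_order all_algebra all_field.
From mathcomp Require Import ring.

Set Implicit Arguments.
Unset Strict Implicit.
Unset Printing Implicit Defensive.

Import Order.TTheory GRing.Theory Num.Theory.
Local Open Scope ring_scope.

(** * Spectra of normal matrices *)

Lemma char_poly_conj (F : fieldType) n (P D : 'M[F]_n) :
  P \in unitmx -> char_poly (invmx P *m D *m P) = char_poly D.
Proof.
move=> Pu; pose Q := map_mx polyC P; pose Q' := map_mx polyC (invmx P).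
have QQ' : Q' *m Q = 1%:M by rewrite -map_mxM mulVmx // map_mx1.
have -> : char_poly (invmx P *m D *m P) = \det (Q' *m char_poly_mx D *m Q).
  congr (\det _); rewrite /char_poly_mx mulmxBr mulmxBl !map_mxM.
  by rewrite scalar_mxC -(mulmxA 'X%:M) QQ' mulmx1.
by rewrite !det_mulmx mulrAC -det_mulmx QQ' det1 mul1r.
Qed.

Section NormalMatrix.
Variables (C : numClosedFieldType) (n : nat) (A : 'M[C]_n).
Hypothesis A_normal : A \is normalmx.

Lemma spectral_conj :
  diag_mx (spectral_diag A) = spectralmx A *m A *m invmx (spectralmx A).
Proof.
have Pu := spectral_unit A.
by rewrite {3}(orthomx_spectralP A_normal) !mulmxA mulmxV // mul1mx mulmxK.
Qed.

Lemma char_poly_normal :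
  char_poly A = \prod_i ('X - (spectral_diag A 0 i)%:P).
Proof.
rewrite (orthomx_spectralP A_normal) char_poly_conj ?spectral_unit //.
rewrite -(orthomx_spectralP A_normal) char_poly_trig ?diag_mx_is_trig //.
by apply: eq_bigr => i _; rewrite mxE eqxx.
Qed.

Lemma spectral_diag_sqr :
  diag_mx (\row_i (spectral_diag A 0 i) ^+ 2) =
  spectralmx A *m (A *m A) *m invmx (spectralmx A).
Proof.
have Pu := spectral_unit A.
rewrite -[LHS](mulmx_diag (spectral_diag A) (spectral_diag A)).
by rewrite spectral_conj !mulmxA mulmxKV.
Qed.

Lemma spectral_diag_cube :
  diag_mx (\row_i (spectral_diag A 0 i) ^+ 3) =
  spectralmx A *m (A *m A *m A) *m invmx (spectralmx A).
Proof.
have Pu := spectral_unit A.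
transitivity (diag_mx (\row_i (spectral_diag A 0 i) ^+ 2) *m
  diag_mx (spectral_diag A)).
  by rewrite mulmx_diag; congr diag_mx; apply/rowP => i; rewrite !mxE exprSr.
by rewrite spectral_diag_sqr spectral_conj !mulmxA mulmxKV.
Qed.

Lemma sum_spectral_diag : \sum_i spectral_diag A 0 i = \tr A.
Proof.
rewrite -mxtrace_diag spectral_conj mxtrace_mulC (mulmxA (invmx _)) mulVmx ?mul1mx //.
exact: spectral_unit.
Qed.

Lemma sum_sqr_spectral_diag : \sum_i spectral_diag A 0 i ^+ 2 = \tr (A *m A).
Proof.
transitivity (\tr (diag_mx (\row_i (spectral_diag A 0 i) ^+ 2))).
  by rewrite mxtrace_diag; apply: eq_bigr => i _; rewrite mxE.
rewrite spectral_diag_sqr mxtrace_mulC (mulmxA (invmx _)) mulVmx ?mul1mx //.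
exact: spectral_unit.
Qed.

(** Conjugating by the unitary [spectralmx A] makes every power of [A] diagonal, so a polynomial
    identity in [A] passes to each eigenvalue. *)
Lemma spectral_diag_cubic (s t : C) i :
    A *m A *m A = s *: (A *m A) + t *: A ->
  spectral_diag A 0 i ^+ 3 =
    s * spectral_diag A 0 i ^+ 2 + t * spectral_diag A 0 i.
Proof.
move=> A3; have := spectral_diag_cube.
rewrite A3 mulmxDr mulmxDl -!scalemxAr -!scalemxAl.
rewrite -spectral_diag_sqr -spectral_conj => /matrixP /(_ i i).
by rewrite !mxE eqxx.
Qed.

End NormalMatrix.

(** * Power sums and energy of the eccentricity spectrum *)

Section EccSpectrum.
Variable G : sgraph.
Local Notation M := (ecc_matrix G).

Hypothesis M_sym : M^T = M.

Lemma ecc_matrix_normal : M \is normalmx.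
Proof.
apply/normalmxP; suff -> : map_mx Num.conj M^T = M by [].
by rewrite M_sym; apply/matrixP => i j; rewrite !mxE conjC_nat.
Qed.

(** Both lists split the same monic characteristic polynomial into linear factors, so they agree up
    to order by unique factorisation. *)
Lemma big_ecc_spectrum (f : algC -> algC) :
  \sum_(x <- ecc_spectrum G) f x = \sum_i f (spectral_diag M 0 i).
Proof.
rewrite -(big_map (fun i => spectral_diag M 0 i) xpredT) /=.
apply: perm_big; apply: prod_XsubC_eq.
rewrite big_map -(char_poly_normal ecc_matrix_normal) /ecc_spectrum.
case: closed_field_poly_normal => r /= charE; rewrite [RHS]charE.
by rewrite (monicP (char_poly_monic _)) scale1r.
Qed.

Lemma sum_sqr_ecc_spectrum :
  \sum_(x <- ecc_spectrum G) x ^+ 2 = \tr (M *m M).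
Proof.
rewrite (big_ecc_spectrum (fun x => x ^+ 2)).
exact: sum_sqr_spectral_diag ecc_matrix_normal.
Qed.

(* On the three possible eigenvalues 0, a and -b, the absolute value is the
   quadratic function x |-> (2 x^2 - (a - b) x) / (a + b). *)
Lemma ecc_energy_cubic (a b : algC) : 0 <= a -> 0 <= b -> \tr M = 0 ->
    M *m M *m M = (a - b) *: (M *m M) + (a * b) *: M ->
  (a + b) * ecc_energy G = 2 * \tr (M *m M).
Proof.
move=> a_ge0 b_ge0 trM M3; have Mn := ecc_matrix_normal.
rewrite /ecc_energy (big_ecc_spectrum Num.norm).
rewrite -(sum_sqr_spectral_diag Mn).
transitivity (\sum_i (2 * spectral_diag M 0 i ^+ 2
                      - (a - b) * spectral_diag M 0 i)); last first.
  by rewrite sumrB -!mulr_sumr sum_spectral_diag // trM mulr0 subr0.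
rewrite mulr_sumr; apply: eq_bigr => i _.
have := spectral_diag_cubic Mn i M3; move: (spectral_diag M 0 i) => x /eqP.
rewrite -subr_eq0.
have -> : x ^+ 3 - ((a - b) * x ^+ 2 + a * b * x) = x * (x - a) * (x + b).
  by ring.
rewrite !mulf_eq0 subr_eq0 addr_eq0 => /orP[/orP[]|] /eqP->.
- by rewrite normr0; ring.
- by rewrite ger0_norm //; ring.
- by rewrite normrN ger0_norm //; ring.
Qed.

End EccSpectrum.

(** * The 0-1 matrices of partitions and their products *)

Section ClassMatrix.
Variable T : finType.

Definition class_mx (X : eqType) (f : T -> X) : 'M[algC]_#|T| :=
  \matrix_(i, j) (f (enum_val i) == f (enum_val j))%:R.

Lemma class_mx_tr (X : eqType) (f : T -> X) : (class_mx f)^T = class_mx f.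
Proof. by apply/matrixP => i j; rewrite !mxE eq_sym. Qed.

Lemma mxtrace_class_mx (X : eqType) (f : T -> X) : \tr (class_mx f) = #|T|%:R.
Proof.
rewrite /mxtrace (eq_bigr (fun=> 1)) => [|i _]; last by rewrite mxE eqxx.
by rewrite sumr_const card_ord.
Qed.

(** Entry (i, j) of the product counts the elements in both the [f]-class of i and the [g]-class of
    j. As [g] refines [f], these form either the whole [g]-class of j, of size [c], or the empty
    set. *)
Lemma class_mx_mulr (X Y : eqType) (f : T -> X) (g : T -> Y) c :
    (forall u v, g u = g v -> f u = f v) ->
    (forall u, #|[pred v | g v == g u]| = c) ->
  class_mx f *m class_mx g = c%:R *: class_mx f.
Proof.
move=> gf cg; apply/matrixP => i j; rewrite !mxE -(cg (enum_val j)).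
rewrite -[in RHS]sum1_card natr_sum mulr_suml.
rewrite [RHS](reindex _ (onW_bij _ (@enum_val_bij T))) [RHS]big_mkcond /=.
apply: eq_bigr => k _; rewrite !mxE inE.
by case: (g _ =P g _) => [/gf->|_]; rewrite ?mulr0 // mul1r mulr1.
Qed.

Lemma class_mx_mull (X Y : eqType) (f : T -> X) (g : T -> Y) c :
    (forall u v, g u = g v -> f u = f v) ->
    (forall u, #|[pred v | g v == g u]| = c) ->
  class_mx g *m class_mx f = c%:R *: class_mx f.
Proof.
move=> gf cg; rewrite -(class_mx_tr g) -{1}(class_mx_tr f) -trmx_mul.
by rewrite (class_mx_mulr gf cg) linearZ /= class_mx_tr.
Qed.

End ClassMatrix.

(** * Eccentricity matrices given by two nested partitions *)

Section TwoPartitions.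
Variables (G : sgraph) (X Y : eqType) (p : G -> X) (q : G -> Y) (c m : nat).
Hypothesis qp : forall u v, q u = q v -> p u = p v.
Hypothesis card_q : forall u, #|[pred v | q v == q u]| = c.
Hypothesis card_p : forall u, #|[pred v | p v == p u]| = m.
Hypothesis entry_pq : forall u v : G,
  ecc_entry u v = if (p u == p v) && (q u != q v) then 2%N else 0%N.

Local Notation M := (ecc_matrix G).
Local Notation P := (class_mx p).
Local Notation Q := (class_mx q).

Lemma ecc_matrix_pq : M = 2 *: (P - Q).
Proof.
apply/matrixP => i j; rewrite !mxE entry_pq.
have [/qp ->|_] := eqVneq (q _) (q _); first by rewrite eqxx subrr mulr0.
by rewrite andbT subr0; case: eqP => _; rewrite ?mulr1 ?mulr0.
Qed.

Lemma ecc_matrix_pq_sym : M^T = M.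
Proof. by rewrite ecc_matrix_pq linearZ /= linearB /= !class_mx_tr. Qed.

Lemma class_mx_products :
  [/\ P *m P = m%:R *: P, P *m Q = c%:R *: P,
      Q *m P = c%:R *: P & Q *m Q = c%:R *: Q].
Proof.
by split; [apply: class_mx_mulr | apply: class_mx_mulr
          | apply: class_mx_mull | apply: class_mx_mulr].
Qed.

Lemma ecc_matrix_pq_sqr :
  M *m M = 4 *: ((m%:R - 2 * c%:R) *: P + c%:R *: Q).
Proof.
have [PP PQ QP QQ] := class_mx_products.
rewrite ecc_matrix_pq -scalemxAl -scalemxAr mulmxBl !mulmxBr PP PQ QP QQ.
by apply/matrixP => i j; rewrite !mxE; ring.
Qed.

(** This is the cubic with roots 0, a = 2(m - c) and -b = -2c, in the shape that [ecc_energy_cubic]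
    expects. *)
Lemma ecc_matrix_pq_cube :
  M *m M *m M = (2 * (m%:R - c%:R) - 2 * c%:R) *: (M *m M)
              + (2 * (m%:R - c%:R) * (2 * c%:R)) *: M.
Proof.
have [PP PQ QP QQ] := class_mx_products.
rewrite ecc_matrix_pq_sqr ecc_matrix_pq -scalemxAl -scalemxAr.
rewrite mulmxDl -!scalemxAl !mulmxBr PP PQ QP QQ.
by apply/matrixP => i j; rewrite !mxE; ring.
Qed.

Lemma mxtrace_ecc_matrix_pq : \tr M = 0.
Proof.
by rewrite ecc_matrix_pq mxtraceZ raddfB /= !mxtrace_class_mx subrr mulr0.
Qed.

Lemma mxtrace_ecc_matrix_pq_sqr : \tr (M *m M) = 4 * (m%:R - c%:R) * #|G|%:R.
Proof.
by rewrite ecc_matrix_pq_sqr mxtraceZ mxtraceD !mxtraceZ !mxtrace_class_mx; ring.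
Qed.

Lemma sum_sqr_ecc_spectrum_pq :
  \sum_(x <- ecc_spectrum G) x ^+ 2 = 4 * (m%:R - c%:R) * #|G|%:R.
Proof.
by rewrite sum_sqr_ecc_spectrum ?mxtrace_ecc_matrix_pq_sqr ?ecc_matrix_pq_sym.
Qed.

Lemma ecc_energy_pq : (c <= m)%N ->
  m%:R * ecc_energy G = 4 * (m%:R - c%:R) * #|G|%:R.
Proof.
(* Here a + b = 2m, so [ecc_energy_cubic] gives twice the claim; [le_cm] ensures that a is
   nonnegative. *)
move=> le_cm; apply: (mulfI (x := 2)); first by rewrite pnatr_eq0.
rewrite -mxtrace_ecc_matrix_pq_sqr.
rewrite -(ecc_energy_cubic ecc_matrix_pq_sym _ _ mxtrace_ecc_matrix_pq
  ecc_matrix_pq_cube); first by ring.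
- by rewrite mulr_ge0 // subr_ge0 ler_nat.
- by rewrite mulr_ge0.
Qed.

End TwoPartitions.

(** * Graphs in which every eccentricity is 2 *)

Section Distance.
Variable G : sgraph.
Implicit Types u v w : G.

Lemma has_walk0 u v : has_walk 0 u v = (u == v).
Proof.
apply/existsP/idP => [[p]|/eqP->]; first by rewrite tuple0 /=.
by exists [tuple]; rewrite /= eqxx.
Qed.

Lemma has_walk1 u v : has_walk 1 u v = adj u v.
Proof.
apply/existsP/idP => [[[[|x []] //= _]]|uv].
  by rewrite andbT => /andP[ux /eqP <-].
by exists [tuple v]; rewrite /= uv eqxx.
Qed.

Lemma has_walk2 u v w : adj u w -> adj w v -> has_walk 2 u v.
Proof.
by move=> uw wv; apply/existsP; exists [tuple w; v]; rewrite /= uw wv eqxx.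
Qed.

(** Since [dist] only tries lengths below [#|G|], a walk of length k is found only if there are more
    than k vertices; exhibiting k + 1 distinct ones settles this. *)
Lemma card_lt_uniq (s : seq G) : uniq s -> (size s <= #|G|)%N.
Proof. by move/card_uniqP <-; apply: max_card. Qed.

Lemma distuu u : dist u u = 0%N.
Proof.
have := card_lt_uniq (s := [:: u]) isT; rewrite /dist.
by case: #|G| => //= N _; rewrite has_walk0 eqxx.
Qed.

Lemma dist_adj u v : adj u v -> dist u v = 1%N.
Proof.
move=> uv; have uDv : u != v by apply: contraTneq uv => ->; rewrite adj_irr.
have := card_lt_uniq (s := [:: u; v]); rewrite /dist /= inE uDv => /(_ isT).
case: #|G| => [|[]] //= N _.
by rewrite has_walk0 (negPf uDv) has_walk1 uv.
Qed.

Lemma dist_common_neighbour u v w :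
  u != v -> ~~ adj u v -> adj u w -> adj w v -> dist u v = 2%N.
Proof.
move=> uDv nuv uw wv.
have uDw : u != w by apply: contraTneq uw => ->; rewrite adj_irr.
have wDv : w != v by apply: contraTneq wv => ->; rewrite adj_irr.
have := card_lt_uniq (s := [:: u; v; w]); rewrite /dist /= !inE negb_or.
rewrite uDv uDw eq_sym wDv => /(_ isT).
case: #|G| => [|[|[]]] //= N _.
by rewrite has_walk0 (negPf uDv) has_walk1 (negPf nuv) (has_walk2 uw wv).
Qed.

Hypothesis common_neighbour : forall u v, u != v -> ~~ adj u v ->
  exists2 w, adj u w & adj w v.
Hypothesis non_neighbour : forall u, exists2 v, u != v & ~~ adj u v.

Lemma dist_diam2 u v :
  dist u v = if u == v then 0%N else if adj u v then 1%N else 2.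
Proof.
case: eqVneq => [->|uDv]; first exact: distuu.
case: ifP => [|/negbT nuv]; first exact: dist_adj.
by have [w] := common_neighbour uDv nuv; apply: dist_common_neighbour.
Qed.

Lemma ecc_diam2 u : ecc u = 2%N.
Proof.
apply/eqP; rewrite eqn_leq; apply/andP; split.
  by apply/bigmax_leqP => v _; rewrite dist_diam2; do 2?case: ifP.
have [v uDv nuv] := non_neighbour u.
apply: leq_trans (leq_bigmax (F := dist u) v).
by rewrite dist_diam2 (negPf uDv) (negPf nuv).
Qed.

Lemma ecc_entry_diam2 u v :
  ecc_entry u v = if (u != v) && ~~ adj u v then 2%N else 0%N.
Proof.
by rewrite /ecc_entry !ecc_diam2 dist_diam2; case: (u == v); case: (adj u v).
Qed.

End Distance.

(** Two vertices realising the diameter lie in a common fibre, which is a singleton, so the diameter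
    is 0; an edge would make it at least 1. *)
Lemma antipodal1_edgeless (G : sgraph) (u v : G) : a_antipodal G 1 -> ~~ adj u v.
Proof.
case=> _ fib; apply/negP => uv.
have G_gt0 : (0 < #|G|)%N by apply/card_gt0P; exists u.
have [x diamE] := bigop.eq_bigmax (@ecc G) G_gt0.
have [y eccE] := bigop.eq_bigmax (dist x) G_gt0.
have xy : dist x y = diam G by rewrite /diam diamE /ecc eccE.
have x_fib : x \in fibre x by rewrite setU11.
have y_fib : y \in fibre x by rewrite !inE xy eqxx orbT.
have /cards1P[z fibE] : #|fibre x| == 1%N by rewrite fib.
move: x_fib y_fib; rewrite fibE !inE => /eqP xz /eqP yz.
have : (dist u v <= diam G)%N.
  apply: leq_trans (leq_bigmax (F := @ecc G) u).
  exact: (leq_bigmax (F := dist u) v).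
by rewrite (dist_adj uv) -xy xz yz distuu.
Qed.

Lemma exists_other_ord n (a : 'I_n.+2) : exists b, a != b.
Proof. by exists (lift a ord0); apply: neq_lift. Qed.

(** * Complete multipartite graphs and their strong products with complete graphs *)

Section Multipartite.
Variables k n : nat.
Local Notation K := (complete_multipartite k.+2 n.+2).

(** A second part supplies the common neighbours, and a second vertex in each part the
    non-neighbours; hence the two shifts by 2 in [K]. *)
Lemma ecc_entry_multipartite (u v : K) :
  ecc_entry u v = if (u.1 == v.1) && (u != v) then 2%N else 0%N.
Proof.
rewrite ecc_entry_diam2 => [|{}u {}v uDv|{v}{}u].
- by rewrite /adj /= /multipartite_adj negbK andbC.
- rewrite /adj /= /multipartite_adj negbK => /eqP uv.
  by have [b ub] := exists_other_ord u.1; exists (b, u.2) => //=; rewrite -uv eq_sym.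
- have [b ub] := exists_other_ord u.2; exists (u.1, b).
    by apply: contraNneq ub => {1}->.
  by rewrite /adj /= /multipartite_adj negbK.
Qed.

Lemma card_part (u : K) : #|[pred v : K | v.1 == u.1]| = n.+2.
Proof.
transitivity #|[predX pred1 u.1 & 'I_n.+2]|.
  by apply: eq_card => v; rewrite !inE andbT.
by rewrite cardX card1 card_ord mul1n.
Qed.

Lemma card_multipartite : #|K| = (k.+2 * n.+2)%N.
Proof. by rewrite card_prod !card_ord. Qed.

Section StrongComplete.
Variable l : nat.
Local Notation S := (strong_product K (complete_graph l)).

(** Any two vertices of a complete graph are equal or adjacent, so the second coordinate never
    obstructs adjacency. *)
Lemma strong_complete_non_adj (x y : S) :
  (x != y) && ~~ adj x y = (x.1.1 == y.1.1) && (x.1 != y.1).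
Proof.
have -> : adj x y = (x != y) && ((x.1 == y.1) || (x.1.1 != y.1.1)).
  rewrite /adj /= /strong_adj; have -> : adj x.2 y.2 = (x.2 != y.2) by [].
  by rewrite orbN andbT.
have [->|_] := eqVneq x y; first by rewrite eqxx andbF.
by rewrite /= negb_or negbK andbC.
Qed.

Lemma ecc_entry_strong_complete (x y : S) :
  ecc_entry x y = if (x.1.1 == y.1.1) && (x.1 != y.1) then 2%N else 0%N.
Proof.
rewrite ecc_entry_diam2 => [|{}x {}y xDy nxy|{x y}[[i a] s]].
- by rewrite strong_complete_non_adj.
- have : (x != y) && ~~ adj x y by rewrite xDy.
  rewrite strong_complete_non_adj => /andP[/eqP xy _].
  have [b xb] := exists_other_ord x.1.1.
  (* [x] and [y] lie over the same part, so any vertex over another part [b] is adjacent to both. *)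
  suff adj_b (z : S) : z.1.1 = x.1.1 -> adj z ((b, x.1.2), x.2).
    by exists ((b, x.1.2), x.2); rewrite ?[adj _ y]adj_sym adj_b.
  move=> zx; apply: contraT => nadj.
  have : (z != ((b, x.1.2), x.2)) && ~~ adj z ((b, x.1.2), x.2).
    by rewrite nadj andbT; apply: contraNneq xb => zE; rewrite -zx zE.
  by rewrite strong_complete_non_adj /= zx (negPf xb).
- have [b ab] := exists_other_ord a.
  pose x : S := ((i, a), s); pose y : S := ((i, b), s).
  suff /andP[] : (x != y) && ~~ adj x y by exists y.
  by rewrite strong_complete_non_adj /= eqxx xpair_eqE eqxx.
Qed.

Lemma card_strong_twins (x : S) : #|[pred y : S | y.1 == x.1]| = l.
Proof.
transitivity #|[predX pred1 x.1 & 'I_l]|.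
  by apply: eq_card => y; rewrite !inE andbT.
by rewrite cardX card1 card_ord mul1n.
Qed.

Lemma card_strong_part (x : S) : #|[pred y : S | y.1.1 == x.1.1]| = (n.+2 * l)%N.
Proof.
transitivity #|[predX [pred v : K | v.1 == x.1.1] & 'I_l]|.
  by apply: eq_card => y; rewrite !inE andbT.
by rewrite cardX card_part card_ord.
Qed.

End StrongComplete.
End Multipartite.

Theorem theorem5 (n : nat) (n_gt0 : (0 < n)%N)
    (h4 : a_antipodal (complete_multipartite 4 n) n)
    (h2 : a_antipodal (complete_multipartite 2 n) n) :
  ~ ecc_cospectral
      (strong_product (complete_multipartite 2 n) (complete_graph 2))
      (complete_multipartite 4 n) /\
  ecc_equienergetic
    (strong_product (complete_multipartite 2 n) (complete_graph 2))
    (complete_multipartite 4 n).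
Proof.
case: n n_gt0 h4 h2 => [|[|n]] // _ _ h2.
  (* For parts of size 1 the graph is a single edge, which contradicts 1-antipodality. *)
  pose u : complete_multipartite 2 1 := (ord0, ord0).
  by have := antipodal1_edgeless u (ord_max, ord0) h2.
set S := strong_product _ _; set K := complete_multipartite 4 _.
have qpS (x y : S) : x.1 = y.1 -> x.1.1 = y.1.1 by move->.
have qpK (u v : K) : u = v -> u.1 = v.1 by move->.
have card_qK (u : K) : #|[pred v | v == u]| = 1%N by rewrite card1.
have card_S : #|S| = (2 * n.+2 * 2)%N.
  by rewrite card_prod card_multipartite card_ord.
split.
  move=> cospec.
  have : \sum_(x <- ecc_spectrum S) x ^+ 2 = \sum_(x <- ecc_spectrum K) x ^+ 2.
    exact: perm_big.
  rewrite (sum_sqr_ecc_spectrum_pq qpS (@card_strong_twins _ _ _)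
    (@card_strong_part _ _ _) (@ecc_entry_strong_complete _ _ _)).
  rewrite (sum_sqr_ecc_spectrum_pq qpK card_qK (@card_part _ _)
    (@ecc_entry_multipartite _ _)).
  rewrite card_S card_multipartite => /eqP; rewrite -subr_eq0.
  (* With N = [n.+2], the sums of squares are 32 N (N - 1) for [S] (c = 2, m = 2N) and 16 N (N - 1)
     for [K] (c = 1, m = N); both graphs have order 4N. *)
  rewrite (_ : _ - _ = (16 * n.+1 * n.+2)%:R) ?pnatr_eq0 //.
  by rewrite -[n.+2]addn1 -[n.+1]addn1 !natrM !natrD; ring.
(* The factor 2N is the part size in [S] and twice that in [K]; both energies equal 16 (N - 1). *)
apply: (mulfI (x := (n.+2 * 2)%:R)); first by rewrite pnatr_eq0.
rewrite (ecc_energy_pq qpS (@card_strong_twins _ _ _)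
    (@card_strong_part _ _ _) (@ecc_entry_strong_complete _ _ _)) ?leq_pmull //.
rewrite [X in _ = X * _]natrM [RHS]mulrAC (ecc_energy_pq qpK card_qK (@card_part _ _)
    (@ecc_entry_multipartite _ _)) //.
by rewrite card_S card_multipartite !natrM; ring.
Qed.
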